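(* Let $F$ be an anti-invariant Riemannian submersion from a Kenmotsu manifold $M(\phi,\xi,\eta,g_M)$ to a Riemannian manifold $(N,g_N)$ such that $\ker F_*\neq\{0\}$ and the characteristic vector field $\xi$ is horizontal. Then $\ker F_*$ does not define a totally geodesic foliation on $M$.
   Context: An almost contact metric structure $(\phi,\xi,\eta,g)$ on a connected $(2m+1)$-dimensional differentiable manifold $M$ consists of a $(1,1)$-tensor field $\phi$, a vector field $\xi$ (the characteristic vector field), a $1$-form $\eta$ and a Riemannian metric $g$ with $\phi^2=-I+\eta\otimes\xi$, $\phi\xi=0$, $\eta\circ\phi=0$, $\eta(\xi)=1$, $g(\phi X,\phi Y)=g(X,Y)-\eta(X)\eta(Y)$, $g(\phi X,Y)+g(X,\phi Y)=0$ and $\eta(X)=g(X,\xi)$ for all vector fields $X,Y$. It is a Kenmotsu manifold if $(\nabla_X\phi)Y=g(\phi X,Y)\xi-\eta(Y)\phi X$ for all $X,Y$, with $\nabla$ the Levi-Civita connection of $g$. A Riemannian submersion $F:(M,g_M)\to(N,g_N)$ is a smooth surjective map of maximal rank (i.e. $F_*$ is surjective at every point) such that $F_*$ preserves the lengths of horizontal vectors; vertical vectors are those in $\ker F_*$, horizontal vectors those in $(\ker F_* )^\perp$. It is anti-invariant if $\phi(\ker F_* )\subseteq(\ker F_* )^\perp$. A distribution $D$ on $M$ defines a totally geodesic foliation if $\nabla_XY\in\Gamma(D)$ for all $X,Y\in\Gamma(D)$, with $\nabla$ the Levi-Civita connection of $g_M$. *)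

(* Defs.v *)
(* Smooth manifolds, built on the Frechet differential of MathComp-Analysis. *)
From HB Require Import structures.
From mathcomp Require Import all_boot all_order all_algebra.
From mathcomp Require Import all_classical all_reals all_analysis.

Set Implicit Arguments.
Unset Strict Implicit.
Unset Printing Implicit Defensive.

Import Order.TTheory GRing.Theory Num.Theory.
Import numFieldNormedType.Exports.

Local Open Scope ring_scope.
Local Open Scope classical_set_scope.

Definition std_basis (R : realType) (n : nat) (i : 'I_n) : 'rV[R]_n :=
  delta_mx 0 i.

Fixpoint partial (R : realType) (n : nat) (s : seq 'I_n) (f : 'rV[R]_n -> R) :
    'rV[R]_n -> R :=
  if s is i :: s' then fun x => 'D_(std_basis R i) (partial s' f) x else f.

(* Meant for open [U]: the iterated partial derivatives on [U] only depend on
   the values of [f] on [U].  Asking that all of them be Frechet differentiable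
   is the same as asking that all of them exist and be continuous. *)
Definition smooth_on (R : realType) (n : nat) (U : set 'rV[R]_n)
    (f : 'rV[R]_n -> R) : Prop :=
  forall (s : seq 'I_n) (x : 'rV[R]_n), U x -> differentiable (partial s f) x.

Definition smooth_map_on (R : realType) (n k : nat) (U : set 'rV[R]_n)
    (f : 'rV[R]_n -> 'rV[R]_k) : Prop :=
  forall j : 'I_k, smooth_on U (fun x => f x 0 j).

(* [chart_coord] and [chart_param] are total functions; only their restrictions
   to [chart_dom] and to its image are meaningful. *)
Record chart (R : realType) (n : nat) (M : topologicalType) : Type := Chart {
  chart_dom : set M;
  chart_coord :> M -> 'rV[R]_n;
  chart_param : 'rV[R]_n -> M;
  open_dom : open chart_dom;
  open_range : open (chart_coord @` chart_dom);
  coordK : forall p : M, chart_dom p -> chart_param (chart_coord p) = p;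
  coord_continuous : forall p : M,
    chart_dom p -> {for p, continuous chart_coord};
  param_continuous : forall x : 'rV[R]_n,
    (chart_coord @` chart_dom) x -> {for x, continuous chart_param} }.

Definition chart_image (R : realType) (n : nat) (M : topologicalType)
  (c : chart R n M) : set 'rV[R]_n := c @` chart_dom c.

Record manifold (R : realType) (n : nat) : Type := Manifold {
  carrier :> topologicalType;
  manifold_hausdorff : hausdorff_space carrier;
  manifold_second_countable : @second_countable carrier;
  atlas : set (chart R n carrier);
  atlas_cover : forall p : carrier, exists2 c, atlas c & chart_dom c p;
  atlas_compatible : forall c d : chart R n carrier, atlas c -> atlas d ->
    smooth_map_on (c @` (chart_dom c `&` chart_dom d)) (d \o chart_param c) }.

(* A chart of the atlas around [p], picked by choice. *)
Definition chart_at (R : realType) (n : nat) (M : manifold R n) (p : M) :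
    chart R n M := projT1 (cid2 (atlas_cover p)).

(* A tangent vector at [p] is represented by its components in [chart_at p].
   As [chart_at] need not depend continuously on the point, these components
   are not meaningful as functions of [p]: smoothness of fields is always
   expressed through [components] and [coord_vector] below, in the charts of
   the atlas. *)
Definition tangent (R : realType) (n : nat) (M : manifold R n) (p : M) :
    normedModType R := 'rV[R]_n.

Section Fields.
Context {R : realType} {n : nat} {M : manifold R n}.

(* v(f) *)
Definition dfun (f : M -> R) (p : M) (v : tangent p) : R :=
  'd (f \o chart_param (chart_at p)) (chart_at p p) v.

(* The components of v in the chart c, to be used for p in the domain of c. *)
Definition components (c : chart R n M) (p : M) (v : tangent p) : 'rV[R]_n :=
  'd (c \o chart_param (chart_at p)) (chart_at p p) v.

(* The vector d/dx^i at p of the chart c. *)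
Definition coord_vector (c : chart R n M) (i : 'I_n) (p : M) : tangent p :=
  'd (chart_at p \o chart_param c) (c p) (std_basis R i).

Definition smooth_in (c : chart R n M) (f : M -> R) : Prop :=
  smooth_on (chart_image c) (f \o chart_param c).

Definition smooth_function (f : M -> R) : Prop :=
  forall c : chart R n M, atlas c -> smooth_in c f.

Definition smooth_field (X : forall p : M, tangent p) : Prop :=
  forall c : chart R n M, atlas c ->
  forall i : 'I_n, smooth_in c (fun p => components c (X p) 0 i).

Definition smooth_form (eta : forall p : M, {scalar tangent p}) : Prop :=
  forall c : chart R n M, atlas c ->
  forall i : 'I_n, smooth_in c (fun p => eta p (coord_vector c i p)).

Definition smooth_endomorphism
    (phi : forall p : M, {linear tangent p -> tangent p}) : Prop :=
  forall c : chart R n M, atlas c -> forall i j : 'I_n,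
    smooth_in c (fun p => components c (phi p (coord_vector c i p)) 0 j).

Record riemannian_metric (g : forall p : M, tangent p -> tangent p -> R) :
    Prop := RiemannianMetric {
  riemannian_linear : forall (p : M) (u : tangent p), scalar (g p u);
  riemannian_sym : forall (p : M) (u v : tangent p), g p u v = g p v u;
  riemannian_pos : forall (p : M) (u : tangent p), u != 0 -> 0 < g p u u;
  riemannian_smooth : forall c : chart R n M, atlas c -> forall i j : 'I_n,
    smooth_in c (fun p => g p (coord_vector c i p) (coord_vector c j p)) }.

Definition tangent_length (g : forall p : M, tangent p -> tangent p -> R)
  (p : M) (v : tangent p) : R := Num.sqrt (g p v v).

(* Z = [X, Y] *)
Definition is_lie_bracket (X Y Z : forall p : M, tangent p) : Prop :=
  forall f : M -> R, smooth_function f -> forall p : M,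
    dfun f (Z p) = dfun (fun q => dfun f (Y q)) (X p)
                   - dfun (fun q => dfun f (X q)) (Y p).

(* [nabla X Y] is the covariant derivative of Y along X; it is only constrained
   on smooth vector fields. *)
Record affine_connection
    (nabla : (forall p : M, tangent p) -> (forall p : M, tangent p) ->
             forall p : M, tangent p) : Prop := AffineConnection {
  connection_smooth : forall X Y, smooth_field X -> smooth_field Y ->
    smooth_field (nabla X Y);
  connection_linear : forall f X X' Y, smooth_function f -> smooth_field X ->
    smooth_field X' -> smooth_field Y -> forall p : M,
    nabla (fun q => f q *: X q + X' q) Y p = f p *: nabla X Y p + nabla X' Y p;
  connection_additive : forall X Y Y', smooth_field X -> smooth_field Y ->
    smooth_field Y' -> forall p : M,
    nabla X (fun q => Y q + Y' q) p = nabla X Y p + nabla X Y' p;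
  connection_leibniz : forall f X Y, smooth_function f -> smooth_field X ->
    smooth_field Y -> forall p : M,
    nabla X (fun q => f q *: Y q) p
    = dfun f (X p) *: Y p + f p *: nabla X Y p }.

(* By the fundamental theorem of Riemannian geometry, there is such a [nabla]
   and its values on smooth vector fields are determined by [g]. *)
Record levi_civita (g : forall p : M, tangent p -> tangent p -> R)
    (nabla : (forall p : M, tangent p) -> (forall p : M, tangent p) ->
             forall p : M, tangent p) : Prop := LeviCivita {
  levi_civita_connection : affine_connection nabla;
  levi_civita_torsion_free : forall X Y, smooth_field X -> smooth_field Y ->
    is_lie_bracket X Y (fun p => nabla X Y p - nabla Y X p);
  levi_civita_metric : forall X Y Z, smooth_field X -> smooth_field Y ->
    smooth_field Z -> forall p : M,
    dfun (fun q => g q (Y q) (Z q)) (X p)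
    = g p (nabla X Y p) (Z p) + g p (Y p) (nabla X Z p) }.

Record almost_contact_metric
    (phi : forall p : M, {linear tangent p -> tangent p})
    (xi : forall p : M, tangent p) (eta : forall p : M, {scalar tangent p})
    (g : forall p : M, tangent p -> tangent p -> R) : Prop :=
    AlmostContactMetric {
  contact_phi_smooth : smooth_endomorphism phi;
  contact_xi_smooth : smooth_field xi;
  contact_eta_smooth : smooth_form eta;
  contact_metric : riemannian_metric g;
  contact_phi2 : forall (p : M) (u : tangent p),
    phi p (phi p u) = - u + eta p u *: xi p;
  contact_phi_xi : forall p : M, phi p (xi p) = 0;
  contact_eta_phi : forall (p : M) (u : tangent p), eta p (phi p u) = 0;
  contact_eta_xi : forall p : M, eta p (xi p) = 1;
  contact_compatible : forall (p : M) (u v : tangent p),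
    g p (phi p u) (phi p v) = g p u v - eta p u * eta p v;
  contact_skew : forall (p : M) (u v : tangent p),
    g p (phi p u) v + g p u (phi p v) = 0;
  contact_dual : forall (p : M) (u : tangent p), eta p u = g p u (xi p) }.

(* (nabla_X phi) Y is nabla_X (phi Y) - phi (nabla_X Y). *)
Definition kenmotsu (phi : forall p : M, {linear tangent p -> tangent p})
    (xi : forall p : M, tangent p) (eta : forall p : M, {scalar tangent p})
    (g : forall p : M, tangent p -> tangent p -> R)
    (nabla : (forall p : M, tangent p) -> (forall p : M, tangent p) ->
             forall p : M, tangent p) : Prop :=
  forall X Y, smooth_field X -> smooth_field Y -> forall p : M,
    nabla X (fun q => phi q (Y q)) p - phi p (nabla X Y p)
    = g p (phi p (X p)) (Y p) *: xi p - eta p (Y p) *: phi p (X p).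

Definition section (D : forall p : M, set (tangent p))
    (X : forall p : M, tangent p) : Prop :=
  smooth_field X /\ forall p : M, D p (X p).

Definition totally_geodesic_foliation
    (nabla : (forall p : M, tangent p) -> (forall p : M, tangent p) ->
             forall p : M, tangent p)
    (D : forall p : M, set (tangent p)) : Prop :=
  forall X Y, section D X -> section D Y -> section D (nabla X Y).

Definition orthogonal_complement (g : forall p : M, tangent p -> tangent p -> R)
    (D : forall p : M, set (tangent p)) (p : M) : set (tangent p) :=
  [set u | forall v : tangent p, D p v -> g p u v = 0].

End Fields.

Section Submersions.
Context {R : realType} {m n : nat} {M : manifold R m} {N : manifold R n}.

Definition smooth_map (F : M -> N) : Prop :=
  continuous F /\
  forall (c : chart R m M) (d : chart R n N), atlas c -> atlas d ->
    smooth_map_on (c @` (chart_dom c `&` F @^-1` chart_dom d))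
      (d \o F \o chart_param c).

(* F_* at p *)
Definition tangent_map (F : M -> N) (p : M) (v : tangent p) : tangent (F p) :=
  'd (chart_at (F p) \o F \o chart_param (chart_at p)) (chart_at p p) v.

Definition vertical (F : M -> N) (p : M) : set (tangent p) :=
  [set v | tangent_map F v = 0].

Definition horizontal (gM : forall p : M, tangent p -> tangent p -> R)
    (F : M -> N) (p : M) : set (tangent p) :=
  orthogonal_complement gM (vertical F) (p := p).

Record riemannian_submersion
    (gM : forall p : M, tangent p -> tangent p -> R)
    (gN : forall q : N, tangent q -> tangent q -> R)
    (F : M -> N) : Prop := RiemannianSubmersion {
  submersion_smooth : smooth_map F;
  submersion_surjective : forall q : N, exists p : M, F p = q;
  submersion_rank : forall (p : M) (w : tangent (F p)),
    exists v : tangent p, tangent_map F v = w;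
  submersion_isometric : forall (p : M) (v : tangent p),
    horizontal gM F v ->
    tangent_length gN (tangent_map F v) = tangent_length gM v }.

Definition anti_invariant (gM : forall p : M, tangent p -> tangent p -> R)
    (phi : forall p : M, {linear tangent p -> tangent p}) (F : M -> N) : Prop :=
  forall (p : M) (v : tangent p), vertical F v -> horizontal gM F (phi p v).

End Submersions.

(* Main.v *)
Require Import Defs.
From HB Require Import structures.
From mathcomp Require Import all_boot all_order all_algebra.
From mathcomp Require Import all_classical all_reals all_analysis.
From mathcomp Require Import ring.
Import Order.TTheory GRing.Theory Num.Theory.
Import numFieldNormedType.Exports.
Local Open Scope ring_scope.
Local Open Scope classical_set_scope.

(** In a Kenmotsu manifold [nabla_X xi = X - eta(X) xi]: taking [Y = xi] in the
    Kenmotsu identity gives [phi (nabla_X xi) = phi X], which determines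
    [nabla_X xi] up to its component along [xi], and that component vanishes
    because [xi] has constant length ([nabla_xi]).  Hence, differentiating
    [g(Y, xi) = 0] along [X] gives [g(nabla_X Y, xi) = - g(X, Y)] for every [Y]
    orthogonal to [xi] ([metric_nabla_xi]).  If [xi] is horizontal and the
    fibres are totally geodesic, then for [X = Y] vertical the left-hand side is
    zero, so every vertical vector field vanishes identically.

    It remains to contradict this by extending a nonzero vertical vector [v]
    at [p] to a smooth vertical field on the whole of [M]
    ([exists_vertical_field]).  In charts [F] is a smooth map [f] between open
    sets, with a Jacobian [J] acting on row vectors from the right.  If [B] is a
    right inverse of the differential at the base point, that is [B J = 1]
    there, and [G = B J], then
      [w = det(G) v - v J adj(G) B]
    is smooth, satisfies [w J = 0] everywhere by [adj(G) G = det(G)], and equals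
    [v] at the base point ([exists_kernel_field]); no division is involved, so
    [w] is smooth also where [G] is singular.  Multiplying [w] by a bump
    function ([exists_bump]) and extending by zero gives a global field, which
    is smooth because the support is compact, hence closed, [M] being Hausdorff
    ([smooth_extend_field]).

    Smoothness means here that all iterated partial derivatives are
    differentiable.  Products, compositions and the function [exp(-1/t)] are all
    treated by one principle ([algebra_smooth]): if a family of differentiable
    functions has its partial derivatives in the algebra that it generates, then
    all functions of this algebra are smooth. *)

Set Implicit Arguments.
Unset Strict Implicit.
Unset Printing Implicit Defensive.

(** * Differentials of maps between normed spaces *)

Lemma near_eq_is_diff (R : numFieldType) (V W : normedModType R)
    (f g : V -> W) (a : V) :
  (\forall x \near a, f x = g x) -> differentiable f a -> is_diff a g ('d f a).
Proof.
move=> fg df.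
have gE : g \o shift a = cst (g a) + 'd f a +o_ 0 id.
  apply/eqaddoP => e e0.
  have /eqaddoP/(_ e e0) := diff_locally df.
  have : \forall y \near 0, f (y + a) = g (y + a).
    by move: fg; rewrite (near_shift 0 a); apply: filterS => y /=; rewrite subr0.
  move=> H1 H2; near=> y.
  have E : (cst (g a) + 'd f a) y = (cst (f a) + 'd f a) y.
    by rewrite /= /cst /= !fctE (nbhs_singleton fg).
  have -> : (g \o shift a - (cst (g a) + 'd f a)) y =
            (f \o shift a - (cst (f a) + 'd f a)) y.
    rewrite [LHS]/= [RHS]/= !fctE /= (nbhs_singleton fg); congr (_ - _).
    by apply/esym; near: y.
  by near: y.
have dg : 'd g a = 'd f a :> (V -> W) by apply: diff_unique => //; exact: diff_continuous.
split; last exact: dg.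
apply/diff_locallyP; rewrite dg; split => //; exact: diff_continuous.
Unshelve. all: by end_near. Qed.

(** Components suffice: [f] is the sum of its components times the vectors of
    the standard basis. *)
Lemma differentiable_rV (R : numFieldType) (V : normedModType R) (n : nat)
    (f : V -> 'rV[R]_n) (x : V) :
  (forall j, differentiable (fun y => f y 0 j) x) -> differentiable f x.
Proof.
move=> df.
have -> : f = \sum_(j < n) (fun y => f y 0 j *: delta_mx 0 j).
  by apply/funext => y; rewrite fct_sumE -row_sum_delta.
by apply: differentiable_sum => j; exact: differentiableZl.
Qed.

Lemma diff_coord (R : realFieldType) (V : normedModType R) (n : nat)
    (f : V -> 'rV[R]_n) (x v : V) (j : 'I_n) :
  differentiable f x -> 'd f x v 0 j = 'D_v (fun y => f y 0 j) x.
Proof.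
move=> df; rewrite -deriveE// derive_mx ?mxE//.
exact: diff_derivable.
Qed.

Lemma differentiable_entry (R : numFieldType) (V : normedModType R) (n : nat)
    (f : V -> 'rV[R]_n) (x : V) (j : 'I_n) :
  differentiable f x -> differentiable (fun y => f y 0 j) x.
Proof.
move=> df; exact: (differentiable_comp df (differentiable_coord _ _ _)).
Qed.

(** * Smooth functions on open sets *)

Section SmoothFunctions.
Context {R : realType} {n : nat}.
Implicit Types (U : set 'rV[R]_n) (f g : 'rV[R]_n -> R).

Lemma partial_rcons (s : seq 'I_n) (i : 'I_n) f :
  partial (rcons s i) f = partial s (fun x => 'D_(std_basis R i) f x).
Proof. by elim: s => //= j s ->. Qed.

Lemma smooth_on_partial U f (i : 'I_n) :
  smooth_on U f -> smooth_on U (fun x => 'D_(std_basis R i) f x).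
Proof. by move=> sf s x Ux; rewrite -partial_rcons; apply: sf. Qed.

Lemma smooth_on_sub U V f : U `<=` V -> smooth_on V f -> smooth_on U f.
Proof. by move=> UV sf s x /UV; apply: sf. Qed.

(** The algebra generated by [P] and the constants.  The constructor
    [algebra_eq] makes membership depend on the values on [U] alone; it is needed
    because differentiation rules only hold on [U]. *)
Inductive algebra_on U (P : ('rV[R]_n -> R) -> Prop) : ('rV[R]_n -> R) -> Prop :=
| algebra_gen f : P f -> algebra_on U P f
| algebra_cst a : algebra_on U P (fun=> a)
| algebra_add f g : algebra_on U P f -> algebra_on U P g ->
    algebra_on U P (fun x => f x + g x)
| algebra_mul f g : algebra_on U P f -> algebra_on U P g ->
    algebra_on U P (fun x => f x * g x)
| algebra_eq f g : (forall x, U x -> f x = g x) -> algebra_on U P f ->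
    algebra_on U P g.

Lemma algebra_sum U P (I : Type) (r : seq I) (F : I -> 'rV[R]_n -> R) :
  (forall i, algebra_on U P (F i)) ->
  algebra_on U P (fun x => \sum_(i <- r) F i x).
Proof.
move=> PF; elim: r => [|i r IH].
  by apply: (algebra_eq (f := fun=> 0)) => [x _|]; [rewrite big_nil|exact: algebra_cst].
apply: (algebra_eq (f := fun x => F i x + \sum_(j <- r) F j x)).
  by move=> x _; rewrite big_cons.
exact: algebra_add.
Qed.

Lemma algebra_prod U P (I : Type) (r : seq I) (F : I -> 'rV[R]_n -> R) :
  (forall i, algebra_on U P (F i)) ->
  algebra_on U P (fun x => \prod_(i <- r) F i x).
Proof.
move=> PF; elim: r => [|i r IH].
  by apply: (algebra_eq (f := fun=> 1)) => [x _|]; [rewrite big_nil|exact: algebra_cst].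
apply: (algebra_eq (f := fun x => F i x * \prod_(j <- r) F j x)).
  by move=> x _; rewrite big_cons.
exact: algebra_mul.
Qed.

(** By the Leibniz rule the algebra generated by [P] is stable under partial
    derivatives as soon as the derivatives of the generators belong to it, so
    every iterated partial derivative of a member is again a member, hence
    differentiable.  This replaces the formulas for iterated derivatives of
    products and compositions. *)
Lemma algebra_smooth U P : open U ->
  (forall f, P f -> forall x, U x -> differentiable f x) ->
  (forall f, P f -> forall i, algebra_on U P (fun x => 'D_(std_basis R i) f x)) ->
  forall f, algebra_on U P f -> smooth_on U f.
Proof.
move=> oU Pdiff Pder.
have key f : algebra_on U P f -> (forall x, U x -> differentiable f x) /\
    forall i, algebra_on U P (fun x => 'D_(std_basis R i) f x).
  elim=> {f} [f Pf|a|f g Af [df Df] Ag [dg Dg]|f g Af [df Df] Ag [dg Dg]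
             |f g fg Af [df Df]].
  - by split; [exact: Pdiff|exact: Pder].
  - split=> [x _|i]; first exact: differentiable_cst.
    apply: (algebra_eq (f := fun=> 0)) (algebra_cst _ _ _) => x _.
    by rewrite derive_cst.
  - split=> [x Ux|i]; first by apply: differentiableD; [exact: df|exact: dg].
    apply: algebra_eq (algebra_add (Df i) (Dg i)) => x Ux.
    by rewrite -deriveD//; apply: diff_derivable; [exact: df|exact: dg].
  - split=> [x Ux|i]; first by apply: differentiableM; [exact: df|exact: dg].
    apply: algebra_eq
      (algebra_add (algebra_mul Af (Dg i)) (algebra_mul Ag (Df i))) => x Ux.
    rewrite [RHS](@deriveM _ _ f g)//; apply: diff_derivable; [exact: df|exact: dg].
  - have nfg x : U x -> \forall y \near x, f y = g y.
      by move=> Ux; apply: filterS (open_nbhs_nbhs (conj oU Ux)) => y /fg.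
    split=> [x Ux|i]; first by have [] := near_eq_is_diff (nfg x Ux) (df x Ux).
    apply: algebra_eq (Df i) => x Ux.
    by apply: near_eq_derive; exact: nfg.
move=> f Af s; suff /key[] : algebra_on U P (partial s f) by [].
by elim: s => //= i s /key[].
Qed.

Lemma smooth_algebra U f : open U -> algebra_on U (smooth_on U) f -> smooth_on U f.
Proof.
move=> oU; apply: algebra_smooth => // {}f sf.
  exact: (sf [::]).
by move=> i; apply: algebra_gen; exact: smooth_on_partial.
Qed.

End SmoothFunctions.

Lemma derive_rV (R : realType) (n : nat) (g : 'rV[R]_n -> R) (y v : 'rV[R]_n) :
  differentiable g y -> 'd g y v = \sum_j v 0 j * 'D_(std_basis R j) g y.
Proof.
move=> dg; rewrite {1}(row_sum_delta v) linear_sum.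
by apply: eq_bigr => j _; rewrite linearZ /= deriveE.
Qed.

(** The chain rule writes the derivatives of [g \o h] with products of
    functions [g' \o h], [g'] smooth, and of smooth functions.  So all these
    functions together generate an algebra to which [algebra_smooth] applies. *)
Lemma smooth_on_comp (R : realType) (n k : nat) (U : set 'rV[R]_n)
    (V : set 'rV[R]_k) (h : 'rV[R]_n -> 'rV[R]_k) (g : 'rV[R]_k -> R) :
  open U -> smooth_map_on U h -> (forall x, U x -> V (h x)) -> smooth_on V g ->
  smooth_on U (g \o h).
Proof.
move=> oU sh UV sg.
pose P f := smooth_on U f \/ exists2 g', smooth_on V g' & f = g' \o h.
have dh x : U x -> differentiable h x.
  by move=> Ux; apply: differentiable_rV => j; exact: (sh j [::]).
apply: (@algebra_smooth _ _ U P) => //.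
- move=> f [sf x /(sf [::])//|[g' sg' ->] x Ux].
  apply: differentiable_comp; first exact: dh.
  by apply: (sg' [::]); exact: UV.
- move=> f [sf|[g' sg' ->]] i; first by apply: algebra_gen; left; exact: smooth_on_partial.
  pose D x := \sum_j 'D_(std_basis R i) (fun y => h y 0 j) x
                * 'D_(std_basis R j) g' (h x).
  apply: (algebra_eq (f := D)).
    move=> x Ux; have dgx : differentiable g' (h x) by apply: (sg' [::]); exact: UV.
    rewrite deriveE; last by apply: differentiable_comp => //; exact: dh.
    rewrite diff_comp//; last exact: dh.
    rewrite /= derive_rV//; apply: eq_bigr => j _; rewrite diff_coord//; exact: dh.
  apply: algebra_sum => j; apply: algebra_mul; apply: algebra_gen.
    by left; exact: smooth_on_partial (sh j).
  right; exists (fun y => 'D_(std_basis R j) g' y) => //; exact: smooth_on_partial.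
- by apply: algebra_gen; right; exists g.
Qed.

(** * Bump functions *)

Section Flat.
Context {R : realType}.

(** For [k = 0] this is the classical flat function [exp(-1/t)]; the powers of
    [1/t] make the family stable under differentiation. *)
Definition flat (k : nat) (t : R) : R :=
  if 0 < t then t^-1 ^+ k * expR (- t^-1) else 0.

Lemma flat_le0 k t : t <= 0 -> flat k t = 0.
Proof. by move=> t0; rewrite /flat ltNge t0. Qed.

Lemma flat_gt0 k t : 0 < t -> 0 < flat k t.
Proof. by move=> t0; rewrite /flat t0 mulr_gt0 ?expR_gt0// exprn_gt0// invr_gt0. Qed.

(** The exponential series gives [exp(1/t) >= t^-(k+2) / (k+2)!].  The exponent
    is chosen so that the bound is quadratic, which gives the zero derivative at
    the origin. *)
Lemma flat_bound k t : `|flat k t| <= (k.+2)`!%:R * t ^+ 2.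
Proof.
have [t0|t0] := leP t 0.
  by rewrite flat_le0// normr0 mulr_ge0// sqr_ge0.
rewrite ger0_norm ?(ltW (flat_gt0 _ t0))// /flat t0 expRN.
rewrite ler_pdivrMr ?expR_gt0//.
have u0 : 0 < t^-1 by rewrite invr_gt0.
have le1 := expR_ge1Dxn k.+1 (ltW u0).
apply: (@le_trans _ _ ((k.+2)`!%:R * t ^+ 2 * (t^-1 ^+ k.+2 / (k.+2)`!%:R))).
  have F0 : (k.+2)`!%:R != 0 :> R by rewrite pnatr_eq0 -lt0n fact_gt0.
  move: F0; set F := _%:R => F0; rewrite -[k.+2]addn2 exprD; set X := t^-1 ^+ k.
  by rewrite (_ : _ * _ * (_ / _) = X)//; field; rewrite F0 gt_eqF.
apply: ler_wpM2l; first by rewrite mulr_ge0// sqr_ge0.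
by apply: le_trans le1; rewrite lerDr.
Qed.

Lemma is_derive_flat k (t : R) :
  is_derive t 1 (flat k) (flat k.+2 t - k%:R * flat k.+1 t).
Proof.
have [t0|t0|->] := ltgtP t 0.
- rewrite !flat_le0 ?ltW// mulr0 subr0.
  apply: (@near_eq_is_derive _ _ _ (cst 0)).
  by near=> s; rewrite flat_le0//; apply: ltW; near: s; exact: lt_nbhsl.
- pose V (s : R) := s^-1.
  have dV : is_derive t 1 V (- t ^- 2 *: 1).
    by apply: is_deriveV; rewrite gt_eqF.
  have dE : is_derive t 1 (expR \o (- V)) (expR (- V t) * - (- t ^- 2 *: 1)).
    exact: is_derive1_comp (is_derive_expR _) (is_deriveN dV).
  have dX := is_deriveX k dV.
  have := is_deriveM dX dE => dM.
  apply: (@near_eq_is_derive _ _ _ (V ^+ k * (expR \o (- V)))).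
    near=> s; rewrite /flat ifT; last by near: s; exact: lt_nbhsr.
    by rewrite !fctE /=.
  apply: is_derive_eq.
  rewrite /flat t0 !fctE /= /V /GRing.scale /= !mulr1 opprK.
  rewrite -!exprVn; case: k {dX dM} => [|k] /=; rewrite !exprS ?expr0; ring.
- rewrite !flat_le0// mulr0 subr0.
  suff H : (fun h => h^-1 *: ((flat k \o shift 0) (h *: 1) - flat k 0)) @ 0^' --> 0.
    apply: DeriveDef; first by apply/cvg_ex; exists 0.
    exact/cvg_lim.
  set C : R := (k.+2)`!%:R.
  have C0 : 0 < C by rewrite ltr0n fact_gt0.
  apply/cvgr0Pnorm_le => e e0; near=> h.
  have h0 : h != 0 by near: h; exact: nbhs_dnbhs_neq.
  rewrite [X in _ - X]flat_le0// subr0 /= addr0 normrZ normfV.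
  rewrite ler_pdivrMl ?normr_gt0//.
  apply: (le_trans (flat_bound _ _)); rewrite -/C /GRing.scale /= mulr1.
  rewrite -real_normK ?num_real// expr2 mulrA mulrC ler_wpM2l//.
  rewrite mulrC -ler_pdivlMr//; near: h; apply: dnbhs0_le; exact: divr_gt0.
Unshelve. all: by end_near. Qed.

Lemma smooth_on_flat (n : nat) (U : set 'rV[R]_n) (Q : 'rV[R]_n -> R) (k : nat) :
  open U -> smooth_on U Q -> smooth_on U (flat k \o Q).
Proof.
move=> oU sQ; have dQ x : U x -> differentiable Q x by exact: (sQ [::]).
have dflat j t : differentiable (flat j) t.
  by apply/derivable1_diffP; have [] := is_derive_flat j t.
(* The derivative of [flat j \o Q] involves [flat j.+1 \o Q] and
   [flat j.+2 \o Q], so all indices are needed at once. *)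
pose P f := smooth_on U f \/ exists j, f = flat j \o Q.
have Pflat j : algebra_on U P (flat j \o Q) by apply: algebra_gen; right; exists j.
apply: (@algebra_smooth _ _ U P) => //.
- move=> f [sf x /(sf [::])//|[j ->] x Ux].
  by apply: differentiable_comp => //; exact: dQ.
- move=> f [sf|[j ->]] i; first by apply: algebra_gen; left; exact: smooth_on_partial.
  apply: (algebra_eq (f := fun x => 'D_(std_basis R i) Q x *
      ((flat j.+2 \o Q) x + - j%:R * (flat j.+1 \o Q) x))).
    move=> x Ux; have dQx := dQ x Ux.
    have dc : differentiable (flat j \o Q) x by apply: differentiable_comp.
    rewrite (deriveE _ dc) (deriveE _ dQx) [in RHS]diff_comp//.
    rewrite /= diff1E// derive1E; have [_ ->] := is_derive_flat j (Q x).
    by rewrite mulNr.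
  apply: algebra_mul; first by apply: algebra_gen; left; exact: smooth_on_partial.
  apply: algebra_add => //; apply: algebra_mul => //; exact: algebra_cst.
Qed.
End Flat.

Lemma smooth_on_coord (R : realType) (n : nat) (i : 'I_n) :
  smooth_on setT (fun x : 'rV[R]_n => x 0 i).
Proof.
apply: (@algebra_smooth _ _ setT (eq (fun x : 'rV[R]_n => x 0 i))).
- exact: openT.
- by move=> _ <- x _; exact: differentiable_coord.
- move=> _ <- j; apply: algebra_eq (algebra_cst _ _ (std_basis R j 0 i)) => x _.
  by rewrite -(@diff_coord _ _ _ id)// diff_val.
- exact: algebra_gen.
Qed.

(** The argument of the flat function uses the Euclidean norm, which is smooth
    when squared, and which dominates the maximum norm of the conclusion. *)
Lemma exists_bump (R : realType) (n : nat) (a : 'rV[R]_n) (r : R) : 0 < r ->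
  exists rho : 'rV[R]_n -> R, [/\ smooth_on setT rho, 0 < rho a &
    forall x, rho x != 0 -> `|x - a| < r].
Proof.
move=> r0.
pose Q (x : 'rV[R]_n) := r ^+ 2 - \sum_i (x 0 i - a 0 i) ^+ 2.
have sQ : smooth_on setT Q.
  apply: smooth_algebra; first exact: openT.
  apply: (algebra_eq (f := fun x => r ^+ 2 +
    -1 * \sum_i (x 0 i + - a 0 i) * (x 0 i + - a 0 i))).
    by move=> x _; rewrite mulN1r.
  apply: algebra_add; first exact: algebra_cst.
  apply: algebra_mul; first exact: algebra_cst.
  apply: algebra_sum => i.
  by apply: algebra_mul; apply: algebra_add; try exact: algebra_cst;
    apply: algebra_gen; exact: smooth_on_coord.
exists (flat 0 \o Q); split.
- by apply: smooth_on_flat => //; exact: openT.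
- apply: flat_gt0; rewrite /Q big1 ?subr0 ?exprn_gt0// => i _.
  by rewrite subrr expr0n.
- move=> x /= Qx; have {Qx} : 0 < Q x.
    by rewrite ltNge; apply: contraNN Qx => /flat_le0 ->.
  rewrite subr_gt0 => Qx; rewrite [ltLHS]/Num.Def.normr/= mx_normrE.
  apply/bigmax_ltP; split => // -[i0 i] _; rewrite !mxE /= (ord1 i0).
  rewrite -(@ltr_pXn2r _ 2)// ?nnegrE ?ltW// real_normK ?num_real//.
  apply: le_lt_trans Qx; rewrite (bigD1 i)//= lerDl sumr_ge0// => j _.
  exact: sqr_ge0.
Qed.

(** * Smooth families of matrices and vectors in the kernel of a differential *)

Section SmoothMatrices.
Context {R : realType} {k : nat} (U : set 'rV[R]_k) (oU : open U).

Definition smooth_mx p q (A : 'rV[R]_k -> 'M[R]_(p, q)) :=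
  forall i j, smooth_on U (fun x => A x i j).

Lemma smooth_mx_cst p q (B : 'M[R]_(p, q)) : smooth_mx (fun=> B).
Proof. by move=> i j; apply: smooth_algebra => //; exact: algebra_cst. Qed.

Lemma smooth_mxM p q r (A : 'rV[R]_k -> 'M[R]_(p, q)) (B : 'rV[R]_k -> 'M[R]_(q, r)) :
  smooth_mx A -> smooth_mx B -> smooth_mx (fun x => A x *m B x).
Proof.
move=> sA sB i j; apply: smooth_algebra => //.
apply: (algebra_eq (f := fun x => \sum_l A x i l * B x l j)).
  by move=> x _; rewrite mxE.
by apply: algebra_sum => l; apply: algebra_mul; exact: algebra_gen.
Qed.

Lemma smooth_det p (A : 'rV[R]_k -> 'M[R]_p) :
  smooth_mx A -> smooth_on U (fun x => \det (A x)).
Proof.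
move=> sA; apply: smooth_algebra => //; apply: algebra_sum => s.
apply: algebra_mul; first exact: algebra_cst.
by apply: algebra_prod => i; exact: algebra_gen.
Qed.

Lemma smooth_adj p (A : 'rV[R]_k -> 'M[R]_p) :
  smooth_mx A -> smooth_mx (fun x => \adj (A x)).
Proof.
move=> sA i j; apply: smooth_algebra => //.
apply: (algebra_eq
    (f := fun x => (-1) ^+ (j + i) * \det (row' j (col' i (A x))))).
  by move=> x _; rewrite mxE.
apply: algebra_mul; first exact: algebra_cst.
apply: algebra_gen; apply: smooth_det => i' j'; under eq_fun do rewrite !mxE.
exact: sA.
Qed.

End SmoothMatrices.

Lemma smooth_map_differentiable (R : realType) (k n : nat) (U : set 'rV[R]_k)
    (f : 'rV[R]_k -> 'rV[R]_n) (x : 'rV[R]_k) :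
  smooth_map_on U f -> U x -> differentiable f x.
Proof. by move=> sf Ux; apply: differentiable_rV => j; exact: (sf j [::]). Qed.

Lemma smooth_jacobian (R : realType) (k n : nat) (U : set 'rV[R]_k)
    (f : 'rV[R]_k -> 'rV[R]_n) :
  open U -> smooth_map_on U f -> smooth_mx U (jacobian f).
Proof.
move=> oU sf i j; apply: smooth_algebra => //.
apply: (algebra_eq (f := fun x => 'D_(std_basis R i) (fun y => f y 0 j) x)).
  move=> x Ux; have dfx := smooth_map_differentiable sf Ux.
  by rewrite mxE diff_coord.
by apply: algebra_gen; exact: smooth_on_partial.
Qed.

(** Any vector of the kernel at a point where the differential is onto extends
    to a smooth field of vectors of the kernels: multiplying the projection
    [v - v J G^-1 B] by [det G] makes it polynomial in the entries of [J], hence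
    smooth also where [G] is singular. *)
Lemma exists_kernel_field (R : realType) (k n : nat) (U : set 'rV[R]_k)
    (f : 'rV[R]_k -> 'rV[R]_n) (a v : 'rV[R]_k) :
  open U -> smooth_map_on U f -> U a ->
  (forall w, exists u, 'd f a u = w) -> 'd f a v = 0 ->
  exists w : 'rV[R]_k -> 'rV[R]_k, [/\ smooth_map_on U w, w a = v &
    forall x, U x -> 'd f x (w x) = 0].
Proof.
move=> oU sf Ua surj dv.
have dfE x u : U x -> 'd f x u = u *m jacobian f x.
  move=> Ux; rewrite -deriveEjacobian; first rewrite deriveE//;
  exact: smooth_map_differentiable sf Ux.
(* The rows of [B] are preimages of the standard basis vectors. *)
pose B := \matrix_(i < n) projT1 (cid (surj (delta_mx 0 i))).
have BJ : B *m jacobian f a = 1%:M.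
  apply/row_matrixP => i; rewrite row_mul rowK rowE mulmx1.
  by case: cid => u /= <-; rewrite dfE.
pose J := jacobian f; pose G x := B *m J x.
have sJ : smooth_mx U J by exact: smooth_jacobian.
have sG : smooth_mx U G by apply: smooth_mxM => //; exact: smooth_mx_cst.
exists (fun x => \det (G x) *: v - v *m J x *m \adj (G x) *m B); split.
- move=> j; apply: smooth_algebra => //.
  apply: (algebra_eq (f := fun x => v 0 j * \det (G x) +
      -1 * (v *m J x *m \adj (G x) *m B) 0 j)).
    by move=> x _; rewrite !mxE mulN1r mulrC.
  apply: algebra_add; apply: algebra_mul; try exact: algebra_cst.
    by apply: algebra_gen; exact: smooth_det.
  apply: algebra_gen; apply: (smooth_mxM oU _ (smooth_mx_cst oU _)).
  apply: smooth_mxM => //; last exact: smooth_adj.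
  by apply: smooth_mxM => //; exact: smooth_mx_cst.
- by rewrite /G BJ det1 scale1r -dfE// dv !mul0mx subr0.
- move=> x Ux; rewrite dfE// mulmxBl -scalemxAl -[_ *m B *m _]mulmxA -/(G x).
  by rewrite -[_ *m \adj _ *m _]mulmxA mul_adj_mx mul_mx_scalar subrr.
Qed.

(** * Charts *)

Section Charts.
Context {R : realType} {n : nat} {M : manifold R n}.
Implicit Types (c e : chart R n M) (W : set M) (q : M).

Lemma atlas_chart_at q : atlas (chart_at q).
Proof. by rewrite /chart_at; case: cid2. Qed.

Lemma chart_dom_at q : chart_dom (chart_at q) q.
Proof. by rewrite /chart_at; case: cid2. Qed.

Lemma image_coordP c W x :
  (c @` (chart_dom c `&` W)) x <->
  chart_image c x /\ W (chart_param c x).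
Proof.
split=> [[q [dq Wq] <-]|[[q dq <-]]]; first by rewrite coordK//; split => //; exists q.
by rewrite coordK// => Wq; exists q.
Qed.

Lemma near_param c q W : chart_dom c q -> open W -> W q ->
  \forall y \near c q, W (chart_param c y).
Proof.
move=> dq oW Wq.
have Ic : (c @` chart_dom c) (c q) by exists q.
have := param_continuous Ic; apply.
by apply: open_nbhs_nbhs; rewrite coordK.
Qed.

Lemma near_image c q : chart_dom c q -> \forall y \near c q, chart_image c y.
Proof. by move=> dq; apply: open_nbhs_nbhs; split; [exact: open_range|exists q]. Qed.

Lemma open_image_coord c W : open W -> open (c @` (chart_dom c `&` W)).
Proof.
move=> oW; rewrite openE => x [q [dq Wq] <-].
apply: filterS (filterI (near_image dq) (near_param dq oW Wq)) => y.
by move=> ?; apply/image_coordP.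
Qed.

Lemma differentiable_transition c e q : atlas c -> atlas e ->
  chart_dom c q -> chart_dom e q -> differentiable (e \o chart_param c) (c q).
Proof.
move=> Ac Ae cq eq; apply: smooth_map_differentiable (atlas_compatible Ac Ae) _.
by exists q.
Qed.

(** The chain rule for [G] read in two charts; with [G] a chart this is the
    transformation rule for components, and with [G] a chart of [N] after [F]
    it computes the tangent map of [F]. *)
Lemma is_diff_change_chart (V : normedModType R) (G : M -> V) c e q :
  atlas c -> atlas e -> chart_dom c q -> chart_dom e q ->
  differentiable (G \o chart_param e) (e q) ->
  is_diff (c q) (G \o chart_param c)
    ('d (G \o chart_param e) (e q) \o 'd (e \o chart_param c) (c q)).
Proof.
move=> Ac Ae cq eq dG.
have dT := differentiable_transition Ac Ae cq eq.
have E : \forall y \near c q,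
    ((G \o chart_param e) \o (e \o chart_param c)) y = (G \o chart_param c) y.
  by apply: filterS (near_param cq (open_dom e) eq) => y /= ey; rewrite coordK.
have qK : (e \o chart_param c) (c q) = e q by rewrite /= coordK.
have dG' : differentiable (G \o chart_param e) ((e \o chart_param c) (c q)).
  by rewrite qK.
have H := near_eq_is_diff E (differentiable_comp dT dG').
split; first by case: H.
case: H => _ H; apply: etrans H _.
apply: etrans (diff_comp dT dG') _.
by rewrite qK.
Qed.

End Charts.

(** * Extension of local vector fields by zero *)

Section ExtensionByZero.
Context {R : realType} {n : nat} {M : manifold R n}.
Variables (c : chart R n M) (W K : set M) (z : 'rV[R]_n -> 'rV[R]_n).

(** [z] gives the components of the field in the chart [c]; they are transported
    to the chart [chart_at q] in which tangent vectors at [q] are represented. *)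
Definition extend_field (q : M) : tangent q :=
  if `[< W q >] then 'd (chart_at q \o chart_param c) (c q) (z (c q)) else 0.

Hypotheses (Ac : atlas c) (oW : open W) (Wc : W `<=` chart_dom c).
Hypotheses (Kclosed : closed K) (KW : K `<=` W).
Hypothesis zK : forall q, W q -> ~ K q -> z (c q) = 0.
Hypothesis sz : smooth_map_on (c @` W) z.

Lemma extend_field_in (q : M) : W q ->
  extend_field q = 'd (chart_at q \o chart_param c) (c q) (z (c q)).
Proof. by move=> Wq; rewrite /extend_field asboolT. Qed.

Lemma extend_field_out (q : M) : ~ K q -> extend_field q = 0.
Proof.
move=> Kq; rewrite /extend_field; case: asboolP => // Wq.
by rewrite zK// linear0.
Qed.

Lemma components0 (e : chart R n M) (q : M) : components e (0 : tangent q) = 0.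
Proof. exact: linear0. Qed.

Lemma components_extend (e : chart R n M) (q : M) : atlas e -> chart_dom e q ->
  W q -> components e (extend_field q) = 'd (e \o chart_param c) (c q) (z (c q)).
Proof.
move=> Ae eq Wq; rewrite extend_field_in// /components.
have Aq := atlas_chart_at q; have dq := chart_dom_at q; have cq := Wc Wq.
have [_ H] := is_diff_change_chart Ac Aq cq dq
  (differentiable_transition Aq Ae dq eq).
exact: esym (congr1 (fun h => h (z (c q))) H).
Qed.

(** [M] is covered by the open set [W], where the components of the field in
    another chart are obtained from [z] by composition with the transition
    map and multiplication by its Jacobian, and by the open complement of [K],
    where the field is zero. *)
Lemma smooth_extend_field : smooth_field extend_field.
Proof.
move=> e Ae i s x [q eq <-{x}].
suff [V [Vq sV]] : exists V : set 'rV[R]_n, V (e q) /\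
    smooth_on V ((fun p => components e (extend_field p) 0 i) \o chart_param e).
  exact: sV.
have [Wq|nWq] := pselect (W q); last first.
  exists (e @` (chart_dom e `&` ~` K)).
  have oV : open (e @` (chart_dom e `&` ~` K)).
    by apply: open_image_coord; exact: closed_openC.
  split; first by exists q; split => // /KW.
  apply: smooth_algebra => //; apply: algebra_eq (algebra_cst _ _ 0) => x.
  by move=> /image_coordP[_ Kx] /=; rewrite extend_field_out// components0 mxE.
pose V := e @` (chart_dom e `&` W); pose V' := c @` (chart_dom e `&` W).
have oV : open V by exact: open_image_coord.
exists V; split; first by exists q.
pose T := c \o chart_param e.
have sT : smooth_map_on V T.
  move=> j; apply: smooth_on_sub (atlas_compatible Ae Ac j).
  by move=> _ [p [ep Wp] <-]; exists p => //; split => //; exact: Wc.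
have TV x : V x -> V' (T x).
  by move=> [p [ep Wp] <-]; exists p => //; rewrite /T /= coordK.
have sT' : smooth_on V' (fun x => (e \o chart_param c) x 0 i).
  apply: smooth_on_sub (atlas_compatible Ac Ae i).
  by move=> _ [p [ep Wp] <-]; exists p => //; split => //; exact: Wc.
have sz' j : smooth_on V' (fun x => z x 0 j).
  by apply: smooth_on_sub (sz j) => _ [p [ep Wp] <-]; exists p.
apply: smooth_algebra => //.
apply: (algebra_eq (f := fun x => \sum_j ((fun y => z y 0 j) \o T) x *
  ((fun y => 'D_(std_basis R j) (fun w => (e \o chart_param c) w 0 i) y) \o T) x)).
  move=> _ [p [ep Wp] <-]; rewrite /T /= coordK// components_extend//.
  have dT := differentiable_transition Ac Ae (Wc Wp) ep.
  rewrite diff_coord// deriveE ?derive_rV//; exact: differentiable_entry.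
apply: algebra_sum => j.
apply: algebra_mul; apply: algebra_gen; apply: smooth_on_comp TV _ => //.
exact: smooth_on_partial.
Qed.

End ExtensionByZero.

(** * Vertical vector fields *)

Section VerticalFields.
Context {R : realType} {m n : nat} {M : manifold R m} {N : manifold R n}.
Variables (F : M -> N) (F_smooth : smooth_map F).

Lemma differentiable_local_expression (c : chart R m M) (d : chart R n N) (q : M) :
  atlas c -> atlas d -> chart_dom c q -> chart_dom d (F q) ->
  differentiable (d \o F \o chart_param c) (c q).
Proof.
move=> Ac Ad cq dq; apply: smooth_map_differentiable (F_smooth.2 c d Ac Ad) _.
by exists q.
Qed.

(** Verticality can be tested in any charts [c] and [d], whereas the tangent map
    is defined with charts that change with the point. *)
Lemma vertical_of_chart (c : chart R m M) (d : chart R n N) (q : M) (u : 'rV[R]_m) :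
  atlas c -> atlas d -> chart_dom c q -> chart_dom d (F q) ->
  'd (d \o F \o chart_param c) (c q) u = 0 ->
  vertical F ('d (chart_at q \o chart_param c) (c q) u : tangent q).
Proof.
move=> Ac Ad cq dq du; rewrite /vertical /= /tangent_map.
set a := chart_at q; set b := chart_at (F q).
have Aa : atlas a by exact: atlas_chart_at.
have Ab : atlas b by exact: atlas_chart_at.
have aq : chart_dom a q by exact: chart_dom_at.
have bq : chart_dom b (F q) by exact: chart_dom_at.
have [_ H] := is_diff_change_chart Ac Aa cq aq
  (differentiable_local_expression Aa Ab aq bq).
rewrite -[LHS]/(('d (b \o F \o chart_param a) (a q) \o
  'd (a \o chart_param c) (c q)) u).
apply: etrans (esym (congr1 (fun h => h u) H)) _.
pose f := d \o F \o chart_param c.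
have oF : open (F @^-1` chart_dom d).
  by apply: open_comp (open_dom d) => x _; exact: F_smooth.1.
have df : differentiable f (c q) by exact: differentiable_local_expression.
have fq : f (c q) = d (F q) by rewrite /f /= coordK.
have db : differentiable (b \o chart_param d) (f (c q)).
  by rewrite fq; exact: differentiable_transition.
have E : \forall y \near c q,
    ((b \o chart_param d) \o f) y = (b \o F \o chart_param c) y.
  by apply: filterS (near_param cq oF dq) => y /= dy; rewrite /f /= coordK.
have [_ H'] := near_eq_is_diff E (differentiable_comp df db).
apply: etrans (congr1 (fun h => h u) H') _.
apply: etrans (congr1 (fun h => h u) (diff_comp df db)) _.
by rewrite /= du linear0.
Qed.

(** A nonzero vertical vector gives a global vertical field: the field of
    [exists_kernel_field] in charts around [p] and [F p], cut off by a bump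
    function. *)
Lemma exists_vertical_field (p : M) (v : tangent p) :
  (forall w : tangent (F p), exists u : tangent p, tangent_map F u = w) ->
  vertical F v -> v != 0 ->
  exists2 X, section (vertical F) X & X p != 0.
Proof.
move=> F_rank v_vert v0.
pose c := chart_at p; pose d := chart_at (F p).
have Ac : atlas c by exact: atlas_chart_at.
have Ad : atlas d by exact: atlas_chart_at.
have cp : chart_dom c p by exact: chart_dom_at.
have dp : chart_dom d (F p) by exact: chart_dom_at.
pose W := chart_dom c `&` F @^-1` chart_dom d.
have oF : open (F @^-1` chart_dom d).
  by apply: open_comp (open_dom d) => x _; exact: F_smooth.1.
have oW : open W by apply: openI => //; exact: open_dom.
have Wp : W p by [].
have oU : open (c @` W) by exact: open_image_coord.
have Ucp : (c @` W) (c p) by exists p.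
have [w [sw wp w0]] := exists_kernel_field oU (F_smooth.2 c d Ac Ad) Ucp F_rank v_vert.
have [r /= r0 rU] : exists2 r : R, 0 < r & ball (c p) r `<=` c @` W.
  by apply/nbhs_ballP; exact: open_nbhs_nbhs.
have r20 : 0 < r / 2 by rewrite divr_gt0.
(* Half the radius keeps the closed ball inside the open set. *)
have [rho [srho rho0 rhoE]] := exists_bump (c p) r20.
pose B := closed_ball (c p) (r / 2).
have BU : B `<=` c @` W.
  apply: subset_trans rU => y; rewrite /B closed_ballE// /closed_ball_ /= => le.
  rewrite -ball_normE /=; apply: le_lt_trans le _.
  by rewrite ltr_pdivrMr// ltr_pMr// ltr1n.
have cB : compact B.
  apply: bounded_closed_compact; last exact: closed_ball_closed.
  exists (`|c p| + r / 2); split; first exact: num_real.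
  move=> x rx y; rewrite /B closed_ballE// /closed_ball_ /= => le.
  apply: ltW; apply: le_lt_trans rx.
  rewrite -[y](subrK (c p)) addrC (le_trans (ler_normD _ _))// lerD2l.
  by rewrite distrC.
pose K := chart_param c @` B.
have cK : closed K.
  apply: (compact_closed (@manifold_hausdorff _ _ M)).
  apply: continuous_compact cB; apply: continuous_in_subspaceT => y /set_mem/BU.
  by case=> q [cq _] <-; apply: param_continuous; exists q.
have KW : K `<=` W by move=> _ [y /BU[q Wq <-] <-]; rewrite coordK//; case: Wq.
pose z x := rho x *: w x.
have sz : smooth_map_on (c @` W) z.
  move=> j; apply: smooth_algebra => //.
  apply: (algebra_eq (f := fun x => rho x * w x 0 j)).
    by move=> x _; rewrite /z mxE.
  apply: algebra_mul; apply: algebra_gen; last exact: sw.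
  exact: smooth_on_sub srho.
have zK q : W q -> ~ K q -> z (c q) = 0.
  move=> [cq _] Kq; rewrite /z; have [->|/rhoE lt] := eqVneq (rho (c q)) 0.
    by rewrite scale0r.
  case: Kq; exists (c q); last by rewrite coordK.
  by rewrite /B closed_ballE// /closed_ball_ /= distrC ltW.
exists (extend_field c W z).
  split; first by apply: (smooth_extend_field Ac oW _ cK KW zK sz) => q [].
  move=> q; have [Wq|nWq] := pselect (W q); last first.
    rewrite (@extend_field_out _ _ _ c W K)//; last by move=> /KW.
    exact: linear0.
  rewrite extend_field_in//.
  apply: (vertical_of_chart Ac Ad Wq.1 Wq.2).
  rewrite /z linearZ /= w0 ?scaler0//; by exists q.
rewrite extend_field_in// /z wp linearZ scaler_eq0 negb_or gt_eqF//=.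
have E : \forall y \near c p, id y = (c \o chart_param c) y.
  by apply: filterS (near_image cp) => _ [q cq <-]; rewrite /= coordK.
have did : differentiable (@id 'rV[R]_m) (c p) by [].
have [_ H] := near_eq_is_diff E did.
rewrite -[X in X != 0]/('d (c \o chart_param c) (c p) v).
have -> : 'd (c \o chart_param c) (c p) v = v.
  by apply: etrans (congr1 (fun h => h v) H) _; rewrite diff_val.
exact: v0.
Qed.

End VerticalFields.

(** * The Levi-Civita connection of a Kenmotsu manifold *)

Section Kenmotsu.
Context {R : realType} {n : nat} {M : manifold R n}.
Implicit Types X Y : forall p : M, tangent p.
Variable nabla : (forall p : M, tangent p) -> (forall p : M, tangent p) ->
                 forall p : M, tangent p.

Lemma smooth_field0 : smooth_field (fun p : M => 0 : tangent p).
Proof.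
move=> c Ac i; apply: smooth_algebra; first exact: open_range.
apply: algebra_eq (algebra_cst _ _ 0) => x _ /=.
by rewrite components0 mxE.
Qed.

Lemma dfun_cst (a : R) (p : M) (v : tangent p) : dfun (fun=> a) v = 0.
Proof.
by have /(congr1 (fun h => h v)) :=
  @diff_cst _ 'rV[R]_n (R : normedModType R) a (chart_at p p).
Qed.

Lemma connection0 X (p : M) : affine_connection nabla -> smooth_field X ->
  nabla X (fun q => 0) p = 0.
Proof.
move=> nabla_aff sX.
have := connection_additive nabla_aff sX smooth_field0 smooth_field0 p.
have -> : (fun q : M => (0 : tangent q) + 0) = (fun q => 0).
  by apply: functional_extensionality_dep => q; rewrite addr0.
by move=> H; apply: (addrI (nabla X (fun=> 0) p)); rewrite addr0.
Qed.

Variables (phi : forall p : M, {linear tangent p -> tangent p})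
  (xi : forall p : M, tangent p) (eta : forall p : M, {scalar tangent p})
  (g : forall p : M, tangent p -> tangent p -> R).
Hypotheses (contact : almost_contact_metric phi xi eta g)
  (nabla_LC : levi_civita g nabla) (M_kenmotsu : kenmotsu phi xi eta g nabla).

Let xi_smooth := contact_xi_smooth contact.
Let g_riem := contact_metric contact.

Lemma metric_xi_xi (p : M) : g (xi p) (xi p) = 1.
Proof. by rewrite -(contact_dual contact) (contact_eta_xi contact). Qed.

(** [phi (nabla_X xi) = phi X] determines [nabla_X xi] up to a multiple of [xi]
    by [phi^2 = - id + eta xi]; the multiple is found from
    [2 g(nabla_X xi, xi) = X (g(xi, xi)) = 0]. *)
Lemma nabla_xi X (p : M) : smooth_field X ->
  nabla X xi p = X p - eta p (X p) *: xi p.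
Proof.
move=> sX.
have phi_nabla : phi p (nabla X xi p) = phi p (X p).
  have := M_kenmotsu sX xi_smooth p.
  have -> : (fun q => phi q (xi q)) = (fun q => 0).
    by apply: functional_extensionality_dep => q; exact: contact_phi_xi contact q.
  rewrite (connection0 _ (levi_civita_connection nabla_LC) sX).
  rewrite -(contact_dual contact) (contact_eta_phi contact) (contact_eta_xi contact).
  by rewrite scale0r scale1r !sub0r => /oppr_inj.
have eta_nabla : eta p (nabla X xi p) = 0.
  have := levi_civita_metric nabla_LC sX xi_smooth xi_smooth p.
  have -> : (fun q => g (xi q) (xi q)) = (fun q => 1).
    by apply/funext => q; exact: metric_xi_xi.
  rewrite dfun_cst [X in _ + X](riemannian_sym g_riem) -(contact_dual contact).
  by move/esym/eqP; rewrite -mulr2n mulrn_eq0 => /eqP.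
have := contact_phi2 contact (nabla X xi p).
rewrite phi_nabla (contact_phi2 contact) eta_nabla scale0r addr0 => H.
by rewrite -[LHS]opprK -H opprD opprK.
Qed.

(** For [X] and [Y] tangent to a submanifold orthogonal to [xi], this says that
    its second fundamental form in the direction [xi] is [- g]. *)
Lemma metric_nabla_xi X Y (p : M) : smooth_field X -> smooth_field Y ->
  (forall q, g (Y q) (xi q) = 0) -> g (nabla X Y p) (xi p) = - g (Y p) (X p).
Proof.
move=> sX sY Yxi.
have := levi_civita_metric nabla_LC sX sY xi_smooth p.
have -> : (fun q => g (Y q) (xi q)) = (fun q => 0) by exact/funext.
rewrite dfun_cst nabla_xi// => /esym/eqP; rewrite addr_eq0 => /eqP ->.
have lin := riemannian_linear g_riem (Y p).
have gN a u v : g (Y p) (a *: u + v) = a * g (Y p) u + g (Y p) v by exact: lin.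
by rewrite addrC -scaleNr gN Yxi mulr0 add0r.
Qed.

End Kenmotsu.

(** * Fibres of anti-invariant submersions *)

Unset Implicit Arguments.
Set Strict Implicit.
Set Printing Implicit Defensive.

Theorem theorem4 (R : realType) (m n : nat)
    (M : manifold R (2 * m + 1)%N) (N : manifold R n)
    (phi : forall p : M, {linear tangent p -> tangent p})
    (xi : forall p : M, tangent p)
    (eta : forall p : M, {scalar tangent p})
    (gM : forall p : M, tangent p -> tangent p -> R)
    (gN : forall q : N, tangent q -> tangent q -> R)
    (nabla : (forall p : M, tangent p) -> (forall p : M, tangent p) ->
             forall p : M, tangent p)
    (F : M -> N)
    (M_connected : connected [set: M])
    (M_contact : almost_contact_metric phi xi eta gM)
    (nabla_LC : levi_civita gM nabla)
    (M_kenmotsu : kenmotsu phi xi eta gM nabla)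
    (N_riemannian : riemannian_metric gN)
    (F_submersion : riemannian_submersion gM gN F)
    (F_anti_invariant : anti_invariant gM phi F)
    (ker_neq0 : exists (p : M) (v : tangent p), vertical F v /\ v != 0)
    (xi_horizontal : forall p : M, horizontal gM F (xi p)) :
  ~ totally_geodesic_foliation nabla (vertical F).
Proof.
move=> geodesic; have [p [v [v_vert v0]]] := ker_neq0.
have [X X_vert Xp0] := exists_vertical_field (submersion_smooth F_submersion)
  (@submersion_rank _ _ _ _ _ _ _ _ F_submersion p) v_vert v0.
have gM_riem := contact_metric M_contact.
have vert_xi Y : section (vertical F) Y -> forall q, gM q (Y q) (xi q) = 0.
  by move=> [_ Y_vert] q; rewrite (riemannian_sym gM_riem); exact: xi_horizontal.
have := metric_nabla_xi M_contact nabla_LC M_kenmotsu p X_vert.1 X_vert.1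
  (vert_xi X X_vert).
rewrite (vert_xi _ (geodesic X X X_vert X_vert)) => /eqP.
by rewrite eq_sym oppr_eq0 gt_eqF// (riemannian_pos gM_riem).
Qed.
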